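(* For every integer $n\ge4$, the maximal rank of $n$-tensors of size $2\times\cdots\times2$ over the complex number field is less than or equal to $2^{n-2}$.
   Context: An $n$-tensor of size $2\times\cdots\times2$ over $\mathbb{C}$ is an array $(t_{i_1,\ldots,i_n})$ with $i_1,\dots,i_n\in\{1,2\}$ and entries in $\mathbb{C}$. A rank one tensor is an outer product of $n$ nonzero vectors; the rank of a tensor is the smallest $s\ge0$ such that it is a sum of $s$ rank one tensors over $\mathbb{C}$. The maximal rank is the maximum of the ranks of all such tensors. *)

(* Defs.v *)
From HB Require Import structures.
From mathcomp Require Import all_boot all_order all_algebra.
From mathcomp Require Import reals.
From mathcomp Require Import complex.

Set Implicit Arguments.
Unset Strict Implicit.
Unset Printing Implicit Defensive.

Import GRing.Theory.
Local Open Scope ring_scope.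

(* The index values 1, 2 are the elements 0, 1 of 'I_2.  A notation rather than
   a definition, so that tensors carry the pointwise additive structure. *)
Notation tensor2 F n := {ffun {ffun 'I_n -> 'I_2} -> F}.

Definition outer_product (F : fieldType) (n : nat)
    (v : 'I_n -> 'rV[F]_2) : tensor2 F n :=
  [ffun i : {ffun 'I_n -> 'I_2} => \prod_(k < n) v k 0 (i k)].

Definition rank_one (F : fieldType) (n : nat) (t : tensor2 F n) : Prop :=
  exists2 v : 'I_n -> 'rV[F]_2, (forall k, v k != 0) & t = outer_product v.

Definition sum_of_rank_ones (F : fieldType) (n : nat) (t : tensor2 F n)
    (s : nat) : Prop :=
  exists2 u : 'I_s -> tensor2 F n,
    (forall j, rank_one (u j)) & t = \sum_(j < s) u j.

Definition is_rank (F : fieldType) (n : nat) (t : tensor2 F n)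
    (s : nat) : Prop :=
  sum_of_rank_ones t s /\ forall s', sum_of_rank_ones t s' -> (s <= s')%N.

(* The first conjunct makes every tensor have a rank, so that [r] really is an
   upper bound for the ranks of all tensors; the second says it is attained. *)
Definition is_maximal_rank (F : fieldType) (n : nat) (r : nat) : Prop :=
  (forall t : tensor2 F n, exists2 s, is_rank t s & (s <= r)%N) /\
  (exists t : tensor2 F n, is_rank t r).

(* Main.v *)
Require Import Defs.
From HB Require Import structures.
From mathcomp Require Import all_boot all_order all_algebra.
From mathcomp Require Import reals.
From mathcomp Require Import complex.
From mathcomp Require Import boolp ring.

Set Implicit Arguments.
Unset Strict Implicit.
Unset Printing Implicit Defensive.

Import Order.TTheory GRing.Theory Num.Theory.
Local Open Scope ring_scope.

(* Splitting off one factor doubles the bound, so everything reduces to showing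
   that a 2x2x2x2 tensor t has rank at most 4.  View t as a linear map sending
   z in C^2 (x) C^2 to a 2x2 matrix t(z), with biquadratic form
   F(x, y) = det t(x (x) y).
   If the discriminant of F(x, _) is not identically 0, t is a combination of
   two slices that are each spanned by two singular matrices, whence rank at
   most 4; likewise for F(_, y).  If both discriminants vanish identically, F is
   the square of a bilinear form, so det t(z) = c det z + beta(z)^2 with beta
   linear, and beta can be brought to one of 0, z00, z00 + z11.
   For c <> 0 it suffices to find a basis (z_r) of isotropic vectors of this
   quadratic form whose dual basis (w_r) consists of rank one tensors, since
   then t = sum_r w_r (x) t(z_r) with every t(z_r) singular.
   For c = 0 and beta <> 0, t = b (x) m + g (x) n with n singular and tangent
   to m, and such tensors are decomposed explicitly. *)

Lemma ord2P (i : 'I_2) : i = 0 \/ i = 1.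
Proof. by case: i => [[|[|//]] h]; [left | right]; apply/val_inj. Qed.

Ltac ord2 i := case: (ord2P i) => ->.

Notation mat F := ('I_2 -> 'I_2 -> F).
Notation tensor4 F := ('I_2 -> 'I_2 -> mat F).

Definition vec2 (F : Type) (a b : F) (i : 'I_2) : F := if i == 0 then a else b.

(** * Determinant, polar form and isotropy of 2x2 matrices *)

Section Matrices.
Variable F : numClosedFieldType.
Implicit Types (m n p q : mat F) (u v r s : 'I_2 -> F).

Definition det2 m := m 0 0 * m 1 1 - m 0 1 * m 1 0.

(** The polar form of the determinant: det (m + n) = det m + [pol m n] + det n. *)
Definition pol m n :=
  m 0 0 * n 1 1 + n 0 0 * m 1 1 - m 0 1 * n 1 0 - n 0 1 * m 1 0.

Lemma vec_eq0P u : u =1 (fun=> 0) \/ (u 0 != 0 \/ u 1 != 0).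
Proof.
have [u0|] := eqVneq (u 0) 0; last by right; left.
have [u1|] := eqVneq (u 1) 0; last by right; right.
by left=> i; ord2 i.
Qed.

Lemma det2_outer u v : det2 (fun k l => u k * v l) = 0.
Proof. by rewrite /det2; ring. Qed.

Lemma det2_eq0_outer m :
  det2 m = 0 -> exists u v, forall k l, m k l = u k * v l.
Proof.
rewrite /det2 => m0.
have [m00|m00] := eqVneq (m 0 0) 0; last first.
  exists (vec2 (m 0 0) (m 1 0)), (vec2 1 (m 0 1 / m 0 0)) => k l.
  ord2 k; ord2 l; rewrite /vec2 /= ?mulr1 //.
    by field.
  apply: (mulfI m00).
  by rewrite -[LHS]subr0 -{1}m0; field.
have [m01|m01] := eqVneq (m 0 1) 0.
  exists (vec2 0 1), (m 1) => k l.
  by ord2 k; ord2 l; rewrite /vec2 /= ?mul1r ?mul0r.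
exists (vec2 (m 0 1) (m 1 1)), (vec2 0 1) => k l.
have m10 : m 1 0 = 0.
  apply: (mulfI m01); rewrite mulr0.
  by move: m0; rewrite m00 mul0r sub0r => /eqP; rewrite oppr_eq0 => /eqP.
by ord2 k; ord2 l; rewrite /vec2 /= ?mulr1 ?mulr0.
Qed.

Lemma vec_collinear u v :
  u 0 != 0 \/ u 1 != 0 -> u 0 * v 1 = u 1 * v 0 ->
  exists k, forall i, v i = k * u i.
Proof.
move=> [u0|u1] e.
  exists (v 0 / u 0) => i; ord2 i; first by field.
  by apply: (mulfI u0); rewrite e; field.
exists (v 1 / u 1) => i; ord2 i; last by field.
by apply: (mulfI u1); rewrite -e; field.
Qed.

Lemma vec_complete u :
  u 0 != 0 \/ u 1 != 0 -> exists v, u 0 * v 1 - u 1 * v 0 = 1.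
Proof.
move=> [u0|u1].
  by exists (vec2 0 (u 0)^-1); rewrite /vec2 /=; field.
by exists (vec2 (- (u 1)^-1) 0); rewrite /vec2 /=; field.
Qed.

(* [pol m (r (x) r') = 0] says that [m] is tangent at [r (x) r'] to the cone of
   singular matrices. *)
Lemma pol_outer_eq0 m (r r' : 'I_2 -> F) :
  r 0 != 0 \/ r 1 != 0 -> r' 0 != 0 \/ r' 1 != 0 ->
  pol m (fun k l => r k * r' l) = 0 ->
  exists s s', forall k l, m k l = r k * s' l + s k * r' l.
Proof.
move=> /vec_complete[s rs] /vec_complete[s' rs'] h.
pose c (a b : 'I_2 -> F) : F := a 0 * b 0 * m 0 0 + a 0 * b 1 * m 0 1
            + a 1 * b 0 * m 1 0 + a 1 * b 1 * m 1 1.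
(* Dual bases of [r, s] and [r', s']. When [m] is expanded, its coefficient at s (x) s' is [pol] of
   [m] and r (x) r'. *)
pose rd := vec2 (s 1) (- s 0); pose sd := vec2 (- r 1) (r 0).
pose rd' := vec2 (s' 1) (- s' 0); pose sd' := vec2 (- r' 1) (r' 0).
exists (fun k => c sd rd' * s k).
exists (fun l => c rd rd' * r' l + c rd sd' * s' l) => k l.
have e : m k l * (r 0 * s 1 - r 1 * s 0) * (r' 0 * s' 1 - r' 1 * s' 0)
  = r k * (c rd rd' * r' l + c rd sd' * s' l) + c sd rd' * s k * r' l
    + pol m (fun k l => r k * r' l) * s k * s' l.
  by rewrite /c /pol /rd /sd /rd' /sd' /vec2 /=; ord2 k; ord2 l; ring.
by move: e; rewrite rs rs' h !mulr1 !mul0r addr0.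
Qed.

(** In the quadratic space of 2x2 matrices the complement of a non-isotropic vector is a
    nondegenerate 3-space, whose totally isotropic subspaces have dimension at most 1. *)
Lemma isotropic_collinear m n n' :
  det2 m != 0 -> det2 n = 0 -> det2 n' = 0 ->
  pol m n = 0 -> pol m n' = 0 -> pol n n' = 0 ->
  (exists i j, n i j != 0) -> exists k, forall i j, n' i j = k * n i j.
Proof.
suff collr m1 (p q u v : 'I_2 -> F) : det2 m1 != 0 -> p 0 != 0 \/ p 1 != 0 ->
    u 0 != 0 \/ u 1 != 0 -> pol m1 (fun k l => p k * u l) = 0 ->
    pol m1 (fun k l => q k * v l) = 0 -> p 0 * q 1 = p 1 * q 0 ->
    exists k, forall i j, q i * v j = k * (p i * u j).
  move=> dm /det2_eq0_outer[r [r' nE]] /det2_eq0_outer[q [q' n'E]] mn mn' nn'.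
  move=> [i [j nij]].
  have [r0|r0] := vec_eq0P r; first by rewrite nE r0 mul0r eqxx in nij.
  have [r'0|r'0] := vec_eq0P r'; first by rewrite nE r'0 mulr0 eqxx in nij.
  (* The polar form of two outer products is a product of two determinants, so the left or the right
     factors are collinear; transposition reduces the second case to the first. *)
  have : (r 0 * q 1 - r 1 * q 0) * (r' 0 * q' 1 - r' 1 * q' 0) = 0.
    by rewrite -nn' /pol !nE !n'E; ring.
  have mrr : pol m (fun k l => r k * r' l) = 0 by rewrite -mn /pol !nE.
  have mqq : pol m (fun k l => q k * q' l) = 0 by rewrite -mn' /pol !n'E.
  move/eqP; rewrite mulf_eq0 !subr_eq0 => /orP[] /eqP e.
    have [k kE] := collr _ _ _ _ _ dm r0 r'0 mrr mqq e.
    by exists k => a b; rewrite n'E nE kE.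
  have [|||k kE] := collr (fun k l => m l k) r' q' r q _ r'0 r0 _ _ e.
  - by move: dm; rewrite /det2 (mulrC (m 0 1)).
  - by rewrite -mrr /pol; ring.
  - by rewrite -mqq /pol; ring.
  by exists k => a b; rewrite n'E nE mulrC kE; ring.
move=> dm p0 u0 mpu mqv /(vec_collinear p0)[k qE].
(* The polar form of [m1] and p (x) u is [f 0 * u 1 - f 1 * u 0]. As [m1] is invertible, [f] is
   nonzero, so it spans [u] and, unless [k = 0], also [v]. *)
pose f l := p 1 * m1 0 l - p 0 * m1 1 l.
have f0 : f 0 != 0 \/ f 1 != 0.
  have [f0|//] := vec_eq0P f; case/negP: dm.
  have f0' := f0 0; have f1' := f0 1; rewrite /f in f0' f1'.
  have e0 : p 0 * det2 m1 = 0.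
    rewrite (_ : _ * _ = m1 0 1 * (p 1 * m1 0 0 - p 0 * m1 1 0)
                 - m1 0 0 * (p 1 * m1 0 1 - p 0 * m1 1 1)); last first.
      by rewrite /det2; ring.
    by rewrite f0' f1' !mulr0 subr0.
  have e1 : p 1 * det2 m1 = 0.
    rewrite (_ : _ * _ = m1 1 1 * (p 1 * m1 0 0 - p 0 * m1 1 0)
                 - m1 1 0 * (p 1 * m1 0 1 - p 0 * m1 1 1)); last first.
      by rewrite /det2; ring.
    by rewrite f0' f1' !mulr0 subr0.
  case: p0 => p0; [move/eqP: e0 | move/eqP: e1];
    by rewrite mulf_eq0 (negPf p0).
have [k0|k0] := eqVneq k 0.
  by exists 0 => i j; rewrite qE k0 !mul0r.
have fu : f 0 * u 1 = f 1 * u 0.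
  by apply/eqP; rewrite -subr_eq0 -mpu /f /pol; apply/eqP; ring.
have fv : f 0 * v 1 = f 1 * v 0.
  apply: (mulfI k0); apply/eqP; rewrite -subr_eq0 -mqv /f /pol !qE.
  by apply/eqP; ring.
have [x uE] := vec_collinear f0 fu.
have [y vE] := vec_collinear f0 fv.
have x0 : x != 0.
  by apply/eqP => x0; case: u0; rewrite uE x0 mul0r eqxx.
by exists (k * y / x) => i j; rewrite qE uE vE; field.
Qed.

(* Two distinct roots of [det (y0 m + y1 n)] give two singular matrices spanning
   the pencil. *)
Lemma pencil_split m n :
  pol m n ^+ 2 - 4 * det2 m * det2 n != 0 ->
  exists a b p q, [/\ det2 p = 0, det2 q = 0,
    forall k l, m k l = a 0 * p k l + b 0 * q k l &
    forall k l, n k l = (a : 'I_2 -> F) 1 * p k l + (b : 'I_2 -> F) 1 * q k l].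
Proof.
move=> dn0.
have [m0|m0] := eqVneq (det2 m) 0.
  have p0 : pol m n != 0.
    by apply: contra_neq dn0 => ->; rewrite m0 expr2; ring.
  pose k := det2 n / pol m n.
  exists (vec2 1 k), (vec2 0 1), m, (fun i j => n i j - k * m i j).
  split=> //; first last.
  - by move=> i j; rewrite /vec2 /=; ring.
  - by move=> i j; rewrite /vec2 /=; ring.
  rewrite (_ : det2 _ = det2 n - k * pol m n + k ^+ 2 * det2 m).
    by rewrite m0 /k; field.
  by rewrite /det2 /pol; ring.
pose d := sqrtC (pol m n ^+ 2 - 4 * det2 m * det2 n).
have dE : d ^+ 2 = pol m n ^+ 2 - 4 * det2 m * det2 n by rewrite sqrtCK.
have d0 : d != 0 by rewrite sqrtC_eq0.
have root e : e ^+ 2 = 1 ->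
    det2 (fun i j => (e * d - pol m n) / (2 * det2 m) * m i j + n i j) = 0.
  move=> e1; set x := _ / _.
  rewrite (_ : det2 _ = x ^+ 2 * det2 m + x * pol m n + det2 n); last first.
    by rewrite /det2 /pol; ring.
  have -> : x ^+ 2 * det2 m + x * pol m n + det2 n
     = (e ^+ 2 * d ^+ 2 - (pol m n ^+ 2 - 4 * det2 m * det2 n)) / (4 * det2 m).
    by rewrite /x; field.
  by rewrite e1 mul1r dE subrr mul0r.
exists (vec2 (det2 m / d) ((d + pol m n) / (2 * d))).
exists (vec2 (- (det2 m / d)) ((d - pol m n) / (2 * d))).
exists (fun i j => (1 * d - pol m n) / (2 * det2 m) * m i j + n i j).
exists (fun i j => (-1 * d - pol m n) / (2 * det2 m) * m i j + n i j).
split.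
- by apply: root; rewrite expr1n.
- by apply: root; rewrite sqrrN expr1n.
- by move=> i j; rewrite /vec2 /=; field; rewrite m0 d0.
- by move=> i j; rewrite /vec2 /=; field; rewrite m0 d0.
Qed.

End Matrices.

(** * Decompositions of order four tensors into few products *)

Section Rank.
Variable F : numClosedFieldType.
Implicit Types (m n p q b g : mat F) (u v r s : 'I_2 -> F) (t : tensor4 F).

(** Zero vectors are allowed, so [d] is only an upper bound for the rank. *)
Definition rank_le d t := exists u v w x : 'I_d -> 'I_2 -> F,
  forall i j k l, t i j k l = \sum_(e < d) u e i * v e j * w e k * x e l.

Lemma eq_rank_le d t t' :
  (forall i j k l, t i j k l = t' i j k l) -> rank_le d t' -> rank_le d t.
Proof.
move=> tt' [u [v [w [x t'E]]]]; exists u, v, w, x => i j k l.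
by rewrite tt' t'E.
Qed.

Lemma rank_leD d d' t t' : rank_le d t -> rank_le d' t' ->
  rank_le (d + d') (fun i j k l => t i j k l + t' i j k l).
Proof.
move=> [u [v [w [x tE]]]] [u' [v' [w' [x' t'E]]]].
pose c (y : 'I_d -> 'I_2 -> F) (y' : 'I_d' -> 'I_2 -> F) e :=
  match split e with inl a => y a | inr a => y' a end.
exists (c u u'), (c v v'), (c w w'), (c x x') => i j k l.
rewrite big_split_ord tE t'E /c; congr (_ + _); apply: eq_bigr => e _.
  by rewrite (unsplitK (inl e : 'I_d + 'I_d')).
by rewrite (unsplitK (inr e : 'I_d + 'I_d')).
Qed.

Lemma rank_le_outer m n : det2 m = 0 -> det2 n = 0 ->
  rank_le 1 (fun i j k l => m i j * n k l).
Proof.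
move=> /det2_eq0_outer[u [v mE]] /det2_eq0_outer[w [x nE]].
exists (fun=> u), (fun=> v), (fun=> w), (fun=> x) => i j k l.
by rewrite big_ord1 mE nE mulrA.
Qed.

Lemma rank_le_outer4 m1 n1 m2 n2 m3 n3 m4 n4 t :
  det2 m1 = 0 -> det2 n1 = 0 -> det2 m2 = 0 -> det2 n2 = 0 ->
  det2 m3 = 0 -> det2 n3 = 0 -> det2 m4 = 0 -> det2 n4 = 0 ->
  (forall i j k l, t i j k l = m1 i j * n1 k l + m2 i j * n2 k l
                             + m3 i j * n3 k l + m4 i j * n4 k l) ->
  rank_le 4 t.
Proof.
pose o m n : tensor4 F := fun i j k l => m i j * n k l.
move=> m1E n1E m2E n2E m3E n3E m4E n4E tE; apply: eq_rank_le tE _.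
apply: (@rank_leD 3 1 (fun i j k l => o m1 n1 i j k l + o m2 n2 i j k l
  + o m3 n3 i j k l) (o m4 n4)); last exact: rank_le_outer.
apply: (@rank_leD 2 1 (fun i j k l => o m1 n1 i j k l + o m2 n2 i j k l)
  (o m3 n3)); last exact: rank_le_outer.
by apply: (@rank_leD 1 1 (o m1 n1) (o m2 n2)); apply: rank_le_outer.
Qed.

Lemma mat_rows m k l :
  m k l = vec2 1 0 k * m 0 l + vec2 0 1 k * m 1 l.
Proof. by ord2 k; rewrite /vec2 /=; ring. Qed.

Lemma rank_le_outerl m n : det2 m = 0 ->
  rank_le 2 (fun i j k l => m i j * n k l).
Proof.
move=> m0; apply: (@eq_rank_le _ _ (fun i j k l =>
  m i j * (vec2 1 0 k * n 0 l) + m i j * (vec2 0 1 k * n 1 l))).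
  by move=> i j k l; rewrite [n k l]mat_rows mulrDr.
by apply: (@rank_leD 1 1 (fun i j k l => m i j * (vec2 1 0 k * n 0 l))
  (fun i j k l => m i j * (vec2 0 1 k * n 1 l)));
  apply: (@rank_le_outer m) => //; apply: det2_outer.
Qed.

Lemma rank_le_outerr m n : det2 n = 0 ->
  rank_le 2 (fun i j k l => m i j * n k l).
Proof.
move=> n0; apply: (@eq_rank_le _ _ (fun i j k l =>
  (vec2 1 0 i * m 0 j) * n k l + (vec2 0 1 i * m 1 j) * n k l)).
  by move=> i j k l; rewrite [m i j]mat_rows mulrDl.
by apply: (@rank_leD 1 1 (fun i j k l => (vec2 1 0 i * m 0 j) * n k l)
  (fun i j k l => (vec2 0 1 i * m 1 j) * n k l));
  apply: (@rank_le_outer (fun i j => _ * _) n) => //; apply: det2_outer.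
Qed.

Lemma rank_le_prod m n : rank_le 4 (fun i j k l => m i j * n k l).
Proof.
apply: (@eq_rank_le _ _ (fun i j k l =>
  (vec2 1 0 i * m 0 j) * n k l + (vec2 0 1 i * m 1 j) * n k l)).
  by move=> i j k l; rewrite [m i j]mat_rows mulrDl.
by apply: (@rank_leD 2 2 (fun i j k l => (vec2 1 0 i * m 0 j) * n k l)
  (fun i j k l => (vec2 0 1 i * m 1 j) * n k l));
  apply: (@rank_le_outerl (fun i j => _ * _) n) => //; apply: det2_outer.
Qed.

Lemma rank_le_swap d t : rank_le d (fun i j => t j i) -> rank_le d t.
Proof.
move=> [u [v [w [x tE]]]]; exists v, u, w, x => i j k l.
by rewrite tE; apply: eq_bigr => e _; rewrite (mulrC (u e j)).
Qed.

Definition act1 g t : tensor4 F :=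
  fun i j k l => g i 0 * t 0 j k l + g i 1 * t 1 j k l.

Lemma rank_le_act1 d g t : rank_le d t -> rank_le d (act1 g t).
Proof.
move=> [u [v [w [x tE]]]].
exists (fun e i => g i 0 * u e 0 + g i 1 * u e 1), v, w, x => i j k l.
rewrite /act1 !tE !mulr_sumr -big_split; apply: eq_bigr => e _ /=.
by ring.
Qed.

Lemma rank_le_act1V d g t : det2 g != 0 -> rank_le d (act1 g t) -> rank_le d t.
Proof.
(* This matrix is the inverse of [g]: the adjugate over the determinant. *)
move=> g0 /(@rank_le_act1 _ (fun i j => (det2 g)^-1 *
  (if i == j then g (if i == 0 then 1 else 0) (if i == 0 then 1 else 0)
   else - g i j))); apply: eq_rank_le => i j k l.
by rewrite /act1; ord2 i; rewrite /=; move: g0; rewrite /det2 => g0; field.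
Qed.

(** The equation characterizes primitive cube roots of unity; below, [- w - 1] stands for the square
    of [w]. *)
Lemma cube_root_unity : exists w : F, w ^+ 2 = - w - 1.
Proof.
pose w : F := (sqrtC (- 3) - 1) / 2; exists w.
have e : sqrtC (- 3) ^+ 2 = - 3 :> F by rewrite sqrtCK.
have -> : w ^+ 2 = (sqrtC (- 3) ^+ 2 - 2 * sqrtC (- 3) + 1) / 4.
  by rewrite /w; field.
by rewrite e /w; field.
Qed.

(* With roots of unity [w] of order 3, averaging [(r + w s) (r' + w s')
   (p + w^2 q) (p' + w^2 q')] kills all monomials but three. *)
Lemma rank_le_tangent m n m' n' :
  det2 n = 0 -> det2 n' = 0 -> pol m n = 0 -> pol m' n' = 0 ->
  rank_le 4 (fun i j k l => m i j * m' k l + n i j * n' k l).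
Proof.
move=> n0 n'0 mn m'n'.
have [r [r' nE]] := det2_eq0_outer n0.
have [p [p' n'E]] := det2_eq0_outer n'0.
have [nz|r0] := vec_eq0P r.
  apply: eq_rank_le (rank_le_prod m m') => i j k l.
  by rewrite nE nz !mul0r addr0.
have [nz|r'0] := vec_eq0P r'.
  apply: eq_rank_le (rank_le_prod m m') => i j k l.
  by rewrite nE nz mulr0 mul0r addr0.
have [nz|p0] := vec_eq0P p.
  apply: eq_rank_le (rank_le_prod m m') => i j k l.
  by rewrite n'E nz mul0r mulr0 addr0.
have [nz|p'0] := vec_eq0P p'.
  apply: eq_rank_le (rank_le_prod m m') => i j k l.
  by rewrite n'E nz !mulr0 addr0.
have [|s [s' mE]] := pol_outer_eq0 (m := m) r0 r'0.
  by rewrite -mn /pol !nE.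
have [|q [q' m'E]] := pol_outer_eq0 (m := m') p0 p'0.
  by rewrite -m'n' /pol !n'E.
have [w w2] := cube_root_unity.
(* The average leaves n (x) n', m (x) m' and s (x) s' (x) q (x) q'; the fourth term cancels the last
   of these. *)
apply: (@rank_le_outer4
  (fun i j => 3^-1 * (r i + s i) * (r' j + s' j))
  (fun k l => (p k + q k) * (p' l + q' l))
  (fun i j => 3^-1 * (r i + w * s i) * (r' j + w * s' j))
  (fun k l => (p k + (- w - 1) * q k) * (p' l + (- w - 1) * q' l))
  (fun i j => 3^-1 * (r i + (- w - 1) * s i) * (r' j + (- w - 1) * s' j))
  (fun k l => (p k + w * q k) * (p' l + w * q' l))
  (fun i j => - s i * s' j) (fun k l => q k * q' l)); try exact: det2_outer.
move=> i j k l; rewrite nE n'E mE m'E.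
by field: w2.
Qed.

End Rank.

(** * Tensors with det t(z) = c det z + beta(z)^2 *)

Section Forms.
Variable F : numClosedFieldType.
Implicit Types (m n p q b g : mat F) (u v r s : 'I_2 -> F) (t : tensor4 F).

Definition comb t (x00 x01 x10 x11 : F) : mat F := fun k l =>
  x00 * t 0 0 k l + x01 * t 0 1 k l + x10 * t 1 0 k l + x11 * t 1 1 k l.

Definition det_form (c : F) b t := forall x00 x01 x10 x11,
  det2 (comb t x00 x01 x10 x11) = c * (x00 * x11 - x01 * x10)
  + (b 0 0 * x00 + b 0 1 * x01 + b 1 0 * x10 + b 1 1 * x11) ^+ 2.

(** Passing to a singular [g'] = g - x b replaces [m] by [m'] = m + x n. If [pol b g' = 0],
    [rank_le_tangent] applies; otherwise b - y g' is a second singular matrix of the pencil, and two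
    products with singular left factor remain. *)
Lemma rank_le_pencil b g m n : det2 b != 0 -> det2 n = 0 -> pol m n = 0 ->
  rank_le 4 (fun i j k l => b i j * m k l + g i j * n k l).
Proof.
move=> b0 n0 mn.
pose d := sqrtC (pol b g ^+ 2 - 4 * det2 b * det2 g).
have dE : d ^+ 2 = pol b g ^+ 2 - 4 * det2 b * det2 g by rewrite sqrtCK.
pose x := (pol b g + d) / (2 * det2 b).
pose g' i j := g i j - x * b i j; pose m' k l := m k l + x * n k l.
have g'0 : det2 g' = 0.
  rewrite (_ : det2 g' = det2 g - x * pol b g + x ^+ 2 * det2 b); last first.
    by rewrite /det2 /pol /g'; ring.
  have -> : det2 g - x * pol b g + x ^+ 2 * det2 b
     = (d ^+ 2 - (pol b g ^+ 2 - 4 * det2 b * det2 g)) / (4 * det2 b).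
    by rewrite /x; field.
  by rewrite dE subrr mul0r.
apply: (@eq_rank_le _ _ _ (fun i j k l => b i j * m' k l + g' i j * n k l)).
  by move=> i j k l; rewrite /m' /g'; ring.
have [p0|p0] := eqVneq (pol b g') 0.
  apply: rank_le_tangent => //.
  have -> : pol m' n = pol m n + 2 * x * det2 n.
    by rewrite /pol /det2 /m'; ring.
  by rewrite mn n0 mulr0 addr0.
pose y := det2 b / pol b g'.
apply: (@eq_rank_le _ _ _ (fun i j k l =>
  g' i j * (y * m' k l + n k l) + (b i j - y * g' i j) * m' k l)).
  by move=> i j k l; ring.
apply: (@rank_leD _ 2 2 (fun i j k l => g' i j * (y * m' k l + n k l))
  (fun i j k l => (b i j - y * g' i j) * m' k l)).
  by apply: (@rank_le_outerl _ g' (fun k l => y * m' k l + n k l)).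
apply: (@rank_le_outerl _ (fun i j => b i j - y * g' i j) m').
rewrite (_ : det2 _ = det2 b - y * pol b g' + y ^+ 2 * det2 g').
  by rewrite g'0 /y; field.
by rewrite /det2 /pol; ring.
Qed.

(** The first nonzero one of the three matrices spans the others; [n3] serves even when all
    vanish. *)
Lemma isotropic_collinear3 m n1 n2 n3 : det2 m != 0 ->
  det2 n1 = 0 -> det2 n2 = 0 -> det2 n3 = 0 ->
  pol m n1 = 0 -> pol m n2 = 0 -> pol m n3 = 0 ->
  pol n1 n2 = 0 -> pol n1 n3 = 0 -> pol n2 n3 = 0 ->
  exists n k1 k2 k3, [/\ det2 n = 0 /\ pol m n = 0,
    forall i j, n1 i j = k1 * n i j, forall i j, n2 i j = k2 * n i j &
    forall i j, n3 i j = k3 * n i j].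
Proof.
move=> m0 d1 d2 d3 m1 m2 m3 n12 n13 n23.
have zero n : (forall i j, n i j = 0) \/ exists i j, n i j != 0.
  have [/forallP h|/forallPn[i /forallPn[j]]] :=
    boolP [forall i, forall j, n i j == 0]; last by right; exists i, j.
  by left=> i j; apply/eqP; have /forallP := h i; apply.
have [z1|nz] := zero n1; last first.
  have [k2 e2] := isotropic_collinear m0 d1 d2 m1 m2 n12 nz.
  have [k3 e3] := isotropic_collinear m0 d1 d3 m1 m3 n13 nz.
  by exists n1, 1, k2, k3; split=> // i j; rewrite mul1r.
have [z2|nz] := zero n2; last first.
  have [k3 e3] := isotropic_collinear m0 d2 d3 m2 m3 n23 nz.
  by exists n2, 0, 1, k3; split=> // i j; rewrite ?z1 ?mul0r ?mul1r.
by exists n3, 0, 0, 1; split=> // i j; rewrite ?z1 ?z2 ?mul0r ?mul1r.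
Qed.

Lemma det_form_swap c b t : det_form c b t ->
  det_form c (fun i j => b j i) (fun i j => t j i).
Proof.
move=> h x00 x01 x10 x11; rewrite (_ : _ + _ = c * (x00 * x11 - x10 * x01)
  + (b 0 0 * x00 + b 0 1 * x10 + b 1 0 * x01 + b 1 1 * x11) ^+ 2); last by ring.
by rewrite -h /comb /det2; ring.
Qed.

(** Acting by [g] on the first index substitutes g^T z for z, which multiplies det z by [det2 g]. *)
Lemma det_form_act1 c b t g : det_form c b t ->
  det_form (c * det2 g) (fun i j => g i 0 * b 0 j + g i 1 * b 1 j) (act1 g t).
Proof.
move=> h x00 x01 x10 x11.
have := h (g 0 0 * x00 + g 1 0 * x10) (g 0 0 * x01 + g 1 0 * x11)
          (g 0 1 * x00 + g 1 1 * x10) (g 0 1 * x01 + g 1 1 * x11).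
set L := det2 _; set L' := det2 _ => e.
have -> : L' = L by rewrite /L /L' /comb /act1 /det2; ring.
by rewrite e /det2; ring.
Qed.

Lemma rank_le_form0 c b t : (forall i j, b i j = 0) -> det_form c b t ->
  rank_le 4 t.
Proof.
move=> b0 h.
have d x00 x01 x10 x11 : x00 * x11 - x01 * x10 = 0 ->
    det2 (comb t x00 x01 x10 x11) = 0.
  by move=> e; rewrite h !b0 e; ring.
apply: (@rank_le_outer4 _ (fun i j => vec2 1 0 i * vec2 1 0 j) (comb t 1 0 0 0)
  (fun i j => vec2 1 0 i * vec2 0 1 j) (comb t 0 1 0 0)
  (fun i j => vec2 0 1 i * vec2 1 0 j) (comb t 0 0 1 0)
  (fun i j => vec2 0 1 i * vec2 0 1 j) (comb t 0 0 0 1));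
  try exact: det2_outer; try by apply: d; ring.
by move=> i j k l; ord2 i; ord2 j; rewrite /comb /vec2 /=; ring.
Qed.

(* The dual basis is [(e0 + w c e1) (x) (e0 + w^2 e1)] for the three cube roots
   of unity [w], together with [e1 (x) e1]. *)
Lemma rank_le_form1_neq0 c t : c != 0 ->
  det_form c (fun i j => vec2 1 0 i * vec2 1 0 j) t -> rank_le 4 t.
Proof.
move=> c0 h.
have [w w2] := cube_root_unity F.
have d x00 x01 x10 x11 : c * (x00 * x11 - x01 * x10) + x00 ^+ 2 = 0 ->
    det2 (comb t x00 x01 x10 x11) = 0.
  by move=> e; rewrite h -[RHS]e /vec2 /=; ring.
apply: (@rank_le_outer4 _
  (fun i j => vec2 1 c i * vec2 1 1 j)
  (comb t 3^-1 3^-1 (3^-1 / c) 0)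
  (fun i j => vec2 1 (w * c) i * vec2 1 (- w - 1) j)
  (comb t 3^-1 (3^-1 * w) (3^-1 * (- w - 1) / c) 0)
  (fun i j => vec2 1 ((- w - 1) * c) i * vec2 1 w j)
  (comb t 3^-1 (3^-1 * (- w - 1)) (3^-1 * w / c) 0)
  (fun i j => vec2 0 1 i * vec2 0 1 j)
  (comb t (- c) 0 0 1)); try exact: det2_outer.
- by apply: d; field.
- by apply: d; field: w2.
- by apply: d; field: w2.
- by apply: d; ring.
by move=> i j k l; ord2 i; ord2 j; rewrite /comb /vec2 /=; field: w2.
Qed.

(** The form vanishes on the kernel of z00, so the images of e01, e10, e11 are isotropic, pairwise
    orthogonal and orthogonal to the invertible t(e00), hence multiples of one singular [n]. Thus t
    = e00 (x) t(e00) + g (x) n, where each term has rank at most 2. *)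
Lemma rank_le_form1_eq0 t :
  det_form 0 (fun i j => vec2 1 0 i * vec2 1 0 j) t -> rank_le 4 t.
Proof.
move=> h.
have d x00 x01 x10 x11 : det2 (comb t x00 x01 x10 x11) = x00 ^+ 2.
  by rewrite h /vec2 /=; ring.
have P x00 x01 x10 x11 y00 y01 y10 y11 :
    pol (comb t x00 x01 x10 x11) (comb t y00 y01 y10 y11) = 2 * x00 * y00.
  rewrite (_ : pol _ _ = det2 (comb t (x00 + y00) (x01 + y01) (x10 + y10)
     (x11 + y11)) - det2 (comb t x00 x01 x10 x11)
     - det2 (comb t y00 y01 y10 y11)); first by rewrite !d; ring.
  by rewrite /pol /det2 /comb; ring.
have [||||||||||n [k1 [k2 [k3 [[n0 _] e1 e2 e3]]]]] := @isotropic_collinear3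
  (comb t 1 0 0 0) (comb t 0 1 0 0) (comb t 0 0 1 0) (comb t 0 0 0 1);
  rewrite ?d ?P ?expr1n ?expr0n ?oner_neq0 ?mulr0 //.
pose e00 : mat F := fun i j => vec2 1 0 i * vec2 1 0 j.
pose g : mat F := fun i j => vec2 (vec2 0 k1 j) (vec2 k2 k3 j) i.
apply: (@eq_rank_le _ _ _ (fun i j k l =>
  e00 i j * comb t 1 0 0 0 k l + g i j * n k l)).
  move=> i j k l; move: (e1 k l) (e2 k l) (e3 k l).
  by ord2 i; ord2 j; rewrite /comb /e00 /g /vec2 /= => f1 f2 f3;
    rewrite -?f1 -?f2 -?f3; ring.
apply: (@rank_leD _ 2 2 (fun i j k l => e00 i j * comb t 1 0 0 0 k l)
  (fun i j k l => g i j * n k l)).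
  by apply: rank_le_outerl; apply: det2_outer.
exact: rank_le_outerr.
Qed.

(** The same argument on the kernel of z00 + z11, spanned by e01, e10 and e11 - e00, gives t = I (x)
    t(e00) + g (x) n, a case of [rank_le_pencil]. *)
Lemma rank_le_form2_eq0 t :
  det_form 0 (fun i j => (i == j)%:R) t -> rank_le 4 t.
Proof.
move=> h.
have d x00 x01 x10 x11 : det2 (comb t x00 x01 x10 x11) = (x00 + x11) ^+ 2.
  by rewrite h /=; ring.
have P x00 x01 x10 x11 y00 y01 y10 y11 :
    pol (comb t x00 x01 x10 x11) (comb t y00 y01 y10 y11)
    = 2 * (x00 + x11) * (y00 + y11).
  rewrite (_ : pol _ _ = det2 (comb t (x00 + y00) (x01 + y01) (x10 + y10)
     (x11 + y11)) - det2 (comb t x00 x01 x10 x11)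
     - det2 (comb t y00 y01 y10 y11)); first by rewrite !d; ring.
  by rewrite /pol /det2 /comb; ring.
have [||||||||||n [k1 [k2 [k3 [[n0 mn] e1 e2 e3]]]]] := @isotropic_collinear3
  (comb t 1 0 0 0) (comb t 0 1 0 0) (comb t 0 0 1 0) (comb t (-1) 0 0 1);
  rewrite ?d ?P ?addNr ?addr0 ?expr1n ?expr0n ?oner_neq0 ?mulr0 //.
pose g : mat F := fun i j => vec2 (vec2 0 k1 j) (vec2 k2 k3 j) i.
apply: (@eq_rank_le _ _ _ (fun i j k l =>
  (i == j)%:R * comb t 1 0 0 0 k l + g i j * n k l)).
  move=> i j k l; move: (e1 k l) (e2 k l) (e3 k l).
  by ord2 i; ord2 j; rewrite /comb /g /vec2 /= => f1 f2 f3;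
    rewrite -?f1 -?f2 -?f3; ring.
apply: (@rank_le_pencil (fun i j => (i == j)%:R)) => //.
by rewrite /det2 /= mulr1 mulr0 subr0 oner_neq0.
Qed.

(* The dual basis is the orbit of [(1, q1) (x) (1, q2)] under the Klein group
   generated by the sign change of [e1] and the exchange of [e0] and [e1] in
   both factors.  By symmetry a single equation, [AB], makes all four vectors
   isotropic; it is solved for [B] and then for [q1], [q2]. *)
Lemma rank_le_form2_neq0 c t : c != 0 ->
  det_form c (fun i j => (i == j)%:R) t -> rank_le 4 t.
Proof.
move=> c0 h.
have d x00 x01 x10 x11 :
    c * (x00 * x11 - x01 * x10) + (x00 + x11) ^+ 2 = 0 ->
    det2 (comb t x00 x01 x10 x11) = 0.
  by move=> e; rewrite h -[RHS]e /=; ring.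
(* [s] will be q1 q2; the conditions let [A] be defined and make [B] nonzero. The value 2 fails only
   for c = 1/2, and then 3 works. *)
have [s [s0 s1 sc]] : exists s : F, [/\ s != 0, 1 - s ^+ 2 != 0 &
    c * s - (1 - s) ^+ 2 != 0].
  have [e|e] := eqVneq (c * 2 - (1 - 2) ^+ 2) 0; last first.
    exists 2; split=> //; first by rewrite pnatr_eq0.
    by rewrite (_ : _ - _ = - 3%:R) ?oppr_eq0 ?pnatr_eq0 //; ring.
  exists 3; split=> //; first by rewrite pnatr_eq0.
    by rewrite (_ : _ - _ = - 8%:R) ?oppr_eq0 ?pnatr_eq0 //; ring.
  rewrite (_ : _ - _ = (c * 2 - (1 - 2) ^+ 2) * (3 / 2) - 5 / 2); last by field.
  by rewrite e mul0r sub0r oppr_eq0 mulf_neq0 ?invr_eq0 ?pnatr_eq0.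
(* Duality of the two bases amounts to [AE] on e00 and e11, and to 2 (q1^2 - q2^2) B = 1 on e01 and
   e10. *)
pose A := (2 * (1 - s ^+ 2))^-1.
have A0 : A != 0 by rewrite invr_eq0 mulf_neq0 ?pnatr_eq0.
have AE : 2 * (1 - s ^+ 2) * A = 1 by rewrite mulfV // -invr_eq0.
pose B := sqrtC (A ^+ 2 * (c * s - (1 - s) ^+ 2) / (c * s)).
have BE : B ^+ 2 = A ^+ 2 * (c * s - (1 - s) ^+ 2) / (c * s) by rewrite sqrtCK.
have B0 : B != 0.
  rewrite sqrtC_eq0; apply: mulf_neq0.
    by apply: mulf_neq0 => //; apply: expf_neq0.
  by rewrite invr_eq0 mulf_neq0.
have AB : c * s * (B ^+ 2 - A ^+ 2) + A ^+ 2 * (1 - s) ^+ 2 = 0.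
  by rewrite BE; field; rewrite c0 s0.
have [q1 [q2 [qs qB]]] : exists q1 q2 : F,
    q1 * q2 = s /\ 2 * (q1 ^+ 2 - q2 ^+ 2) * B = 1.
  (* Substituting q2 = s / q1 in q1^2 - q2^2 = [D] gives a quadratic equation for [X] = q1^2. *)
  pose D := (2 * B)^-1; pose E := sqrtC (D ^+ 2 + 4 * s ^+ 2).
  have EE : E ^+ 2 = D ^+ 2 + 4 * s ^+ 2 by rewrite sqrtCK.
  pose X := (D + E) / 2.
  have XE : X ^+ 2 - D * X - s ^+ 2 = 0.
    rewrite (_ : _ - _ = (E ^+ 2 - (D ^+ 2 + 4 * s ^+ 2)) / 4).
      by rewrite EE subrr mul0r.
    by rewrite /X; field.
  have X0 : X != 0.
    apply: contra_eq_neq XE => ->.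
    by rewrite expr0n mulr0 subrr sub0r oppr_eq0 expf_neq0.
  have q0 : sqrtC X != 0 by rewrite sqrtC_eq0.
  exists (sqrtC X), (s / sqrtC X); split; first by field.
  rewrite expr_div_n sqrtCK.
  have -> : X - s ^+ 2 / X = D.
    apply/eqP; rewrite -subr_eq0.
    have -> : X - s ^+ 2 / X - D = (X ^+ 2 - D * X - s ^+ 2) / X by field.
    by rewrite XE mul0r.
  by rewrite /D; field.
apply: (@rank_le_outer4 _
  (fun i j => vec2 1 q1 i * vec2 1 q2 j)
  (comb t A (- (q2 * B)) (q1 * B) (- (s * A)))
  (fun i j => vec2 1 (- q1) i * vec2 1 (- q2) j)
  (comb t A (q2 * B) (- (q1 * B)) (- (s * A)))
  (fun i j => vec2 q1 1 i * vec2 q2 1 j)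
  (comb t (- (s * A)) (q1 * B) (- (q2 * B)) A)
  (fun i j => vec2 q1 (- 1) i * vec2 q2 (- 1) j)
  (comb t (- (s * A)) (- (q1 * B)) (q2 * B) A)); try exact: det2_outer.
1-4: by apply: d; rewrite -[RHS]AB -qs; ring.
move=> i j k l; rewrite -[LHS]mulr1.
by ord2 i; ord2 j; [rewrite -[X in _ * X = _]AE | rewrite -[X in _ * X = _]qB
  | rewrite -[X in _ * X = _]qB | rewrite -[X in _ * X = _]AE];
  rewrite -qs /comb /vec2 /=; ring.
Qed.

End Forms.

(** * Normal forms, discriminants and the bound 4 in order four *)

Section Order4.
Variable F : numClosedFieldType.
Implicit Types (m n p q b g : mat F) (u v r s : 'I_2 -> F) (t : tensor4 F).

Lemma eq_det_form c c' b b' t : c = c' -> (forall i j, b i j = b' i j) ->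
  det_form c b t -> det_form c' b' t.
Proof. by move=> <- bb' h x00 x01 x10 x11; rewrite h !bb'. Qed.

(** Determinant 1 ensures that acting by [g] keeps the constant [c] of a [det_form]. *)
Lemma vec_normalize r : r 0 != 0 \/ r 1 != 0 ->
  exists g, det2 g = 1 /\ forall i, g i 0 * r 0 + g i 1 * r 1 = vec2 1 0 i.
Proof.
move=> /vec_complete[s rs].
exists (fun i j => vec2 (vec2 (s 1) (- s 0) j) (vec2 (- r 1) (r 0) j) i).
split; first by rewrite -rs /det2 /vec2 /=; ring.
by move=> i; ord2 i; rewrite /vec2 /= -?rs; ring.
Qed.

(** The rank of [b] selects the normal form. The inverse of [b], acting on the first index, turns an
    invertible [b] into the identity; a nonzero r (x) r' becomes e0 (x) e0 after a change of basis
    in each of the first two indices. *)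
Lemma rank_le_form c b t : det_form c b t -> rank_le 4 t.
Proof.
move=> h.
have [/det2_eq0_outer[r [r' bE]]|b0] := eqVneq (det2 b) 0; last first.
  pose g i j := vec2 (vec2 (b 1 1) (- b 0 1) j) (vec2 (- b 1 0) (b 0 0) j) i
                / det2 b.
  have gE : det2 g = (det2 b)^-1.
    by move: b0; rewrite /g /det2 /vec2 /= => b0; field.
  have g0 : det2 g != 0 by rewrite gE invr_neq0.
  apply: (rank_le_act1V g0).
  have hg : det_form (c * det2 g) (fun i j => (i == j)%:R) (act1 g t).
    apply: eq_det_form (det_form_act1 g h) => // i j.
    by ord2 i; ord2 j; move: b0; rewrite /g /det2 /vec2 /= => b0; field.
  have [c0|c0] := eqVneq c 0.
    by apply: rank_le_form2_eq0; rewrite c0 mul0r in hg.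
  by apply: rank_le_form2_neq0 hg; rewrite mulf_neq0.
have [r0|/vec_normalize[g [g1 gr]]] := vec_eq0P r.
  by apply: rank_le_form0 h => i j; rewrite bE r0 mul0r.
have [r'0|/vec_normalize[g' [g'1 gr']]] := vec_eq0P r'.
  by apply: rank_le_form0 h => i j; rewrite bE r'0 mulr0.
apply: (@rank_le_act1V F _ g); first by rewrite g1 oner_neq0.
apply: rank_le_swap.
apply: (@rank_le_act1V F _ g'); first by rewrite g'1 oner_neq0.
have /(det_form_act1 g')h' := det_form_swap (det_form_act1 g h).
have {}h' : det_form c (fun i j => vec2 1 0 i * vec2 1 0 j)
              (act1 g' (fun i j => act1 g t j i)).
  apply: eq_det_form h'; first by rewrite g1 g'1 !mulr1.
  by move=> i j; rewrite !bE -gr' -gr; ring.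
have [c0|c0] := eqVneq c 0; last exact: rank_le_form1_neq0 h'.
by rewrite c0 in h'; apply: rank_le_form1_eq0 h'.
Qed.

(** By [pencil_split] the slices along [x] and [y] take two products each, and [t] is recovered from
    them because [x] and [y] form a basis. *)
Lemma rank_le_slices t (x y : 'I_2 -> F) :
  let pencil z j k l := z 0 * t 0 j k l + z 1 * t 1 j k l in
  let disc z := pol (pencil z 0) (pencil z 1) ^+ 2
                - 4 * det2 (pencil z 0) * det2 (pencil z 1) in
  x 0 * y 1 - x 1 * y 0 != 0 -> disc x != 0 -> disc y != 0 -> rank_le 4 t.
Proof.
move=> pencil disc xy.
move=> /pencil_split[a [a' [p [p' [p0 p'0 x0 x1]]]]].
move=> /pencil_split[b [b' [q [q' [q0 q'0 y0 y1]]]]].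
have xE j k l : pencil x j k l = a j * p k l + a' j * p' k l by ord2 j.
have yE j k l : pencil y j k l = b j * q k l + b' j * q' k l by ord2 j.
pose d := x 0 * y 1 - x 1 * y 0.
pose u := vec2 (y 1 / d) (- y 0 / d); pose v := vec2 (- x 1 / d) (x 0 / d).
apply: (@rank_le_outer4 _ (fun i j => u i * a j) p (fun i j => u i * a' j) p'
  (fun i j => v i * b j) q (fun i j => v i * b' j) q') => //;
  try exact: det2_outer.
move=> i j k l.
transitivity (u i * pencil x j k l + v i * pencil y j k l); last first.
  by rewrite xE yE; ring.
by rewrite /u /v /pencil /d; ord2 i; rewrite /vec2 /=; field.
Qed.

Lemma poly_nonroot (p : {poly F}) : p != 0 -> exists x, p.[x] != 0.
Proof.
move=> p0; apply: contrapT => /forallNP h.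
pose rs : seq F := [seq i%:R | i <- iota 0 (size p)].
have : all (root p) rs.
  by apply/allP => x _; apply/negPn/negP => hx; apply: (h x).
move=> /(max_poly_roots p0); rewrite map_inj_uniq ?iota_uniq; last first.
  exact: (mulrIn (oner_neq0 F)).
by move=> /(_ isT); rewrite size_map size_iota ltnn.
Qed.

Lemma quartic_nonroots (c0 c1 c2 c3 c4 : F) :
  let q x := c0 + c1 * x + c2 * x ^+ 2 + c3 * x ^+ 3 + c4 * x ^+ 4 in
  (exists x y, [/\ x != y, q x != 0 & q y != 0]) \/
  [/\ c0 = 0, c1 = 0, c2 = 0, c3 = 0 & c4 = 0].
Proof.
move=> q; pose p := Poly [:: c0; c1; c2; c3; c4].
have pE x : p.[x] = q x by rewrite horner_Poly /= /q; ring.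
have [p0|/[dup] p0 /poly_nonroot[x qx]] := eqVneq p 0.
  right; have c i : [:: c0; c1; c2; c3; c4]`_i = 0.
    by rewrite -coef_Poly -/p p0 coef0.
  by split; [exact: (c 0)|exact: (c 1)|exact: (c 2)|exact: (c 3)|exact: (c 4)].
(* A nonroot of this product is a nonroot of [p] other than [x]. *)
have [|y] := @poly_nonroot (p * ('X - x%:P)).
  by rewrite mulf_neq0 ?polyXsubC_eq0.
rewrite hornerM mulf_eq0 negb_or hornerXsubC subr_eq0 => /andP[qy yx].
by left; exists x, y; rewrite -!pE eq_sym.
Qed.

(* [m_ab] is the coefficient of [x^a y^b] in a biquadratic polynomial, and the
   hypotheses are coefficients of its two discriminants. *)
Lemma biquadratic_square_corner (m00 m01 m02 m10 m11 m12 m20 m21 m22 : F) :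
  m00 != 0 ->
  m01 ^+ 2 - 4 * m00 * m02 = 0 ->
  2 * m01 * m11 - 4 * (m00 * m12 + m10 * m02) = 0 ->
  m11 ^+ 2 + 2 * m01 * m21 - 4 * (m00 * m22 + m10 * m12 + m20 * m02) = 0 ->
  m10 ^+ 2 - 4 * m00 * m20 = 0 ->
  2 * m10 * m11 - 4 * (m00 * m21 + m01 * m20) = 0 ->
  exists b00 b01 b10 b11 : F,
  [/\ m00 = b00 ^+ 2, m01 = 2 * b00 * b01 & m02 = b01 ^+ 2] /\
  [/\ m10 = 2 * b00 * b10, m11 = 2 * (b00 * b11 + b01 * b10)
    & m12 = 2 * b01 * b11] /\
  [/\ m20 = b10 ^+ 2, m21 = 2 * b10 * b11 & m22 = b11 ^+ 2].
Proof.
move=> m0 y0 y1 y2 x0 x1.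
(* The coefficients [m00], [m01], [m10], [m11] prescribe the bilinear form. Each of the other five
   is then determined by one hypothesis, where it carries the nonzero factor 4 m00. *)
pose b := sqrtC m00; have b0 : b != 0 by rewrite sqrtC_eq0.
have bE : m00 = b ^+ 2 by rewrite sqrtCK.
move: bE b0 {m0}; move: b => b bE b0; subst m00.
pose b01 := m01 / (2 * b); have e01 : m01 = 2 * b * b01 by rewrite /b01; field.
pose b10 := m10 / (2 * b); have e10 : m10 = 2 * b * b10 by rewrite /b10; field.
move: b01 b10 e01 e10 => b01 b10 e01 e10; subst m01 m10.
pose b11 := (m11 / 2 - b01 * b10) / b.
have e11 : m11 = 2 * (b * b11 + b01 * b10) by rewrite /b11; field.
move: b11 e11 => b11 e11; subst m11.
have b4 : 4 * b ^+ 2 != 0 by rewrite mulf_neq0 ?expf_neq0 ?pnatr_eq0.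
have solve (m w : F) : 4 * b ^+ 2 * w - 4 * b ^+ 2 * m = 0 -> m = w.
  by move/eqP; rewrite subr_eq0 => /eqP /(mulfI b4).
have e02 : m02 = b01 ^+ 2 by apply: solve; rewrite -[RHS]y0; ring.
have e20 : m20 = b10 ^+ 2 by apply: solve; rewrite -[RHS]x0; ring.
subst m02 m20.
have e12 : m12 = 2 * b01 * b11 by apply: solve; rewrite -[RHS]y1; ring.
have e21 : m21 = 2 * b10 * b11 by apply: solve; rewrite -[RHS]x1; ring.
subst m12 m21.
have e22 : m22 = b11 ^+ 2 by apply: solve; rewrite -[RHS]y2; ring.
by exists b, b01, b10, b11.
Qed.

(** Reversing the exponents of x or y moves a nonzero corner coefficient to [m00]. If all four
    corners vanish, the discriminants kill the edge coefficients and then [m11]. *)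
Lemma biquadratic_square (m00 m01 m02 m10 m11 m12 m20 m21 m22 : F) :
  m01 ^+ 2 - 4 * m00 * m02 = 0 ->
  2 * m01 * m11 - 4 * (m00 * m12 + m10 * m02) = 0 ->
  m11 ^+ 2 + 2 * m01 * m21 - 4 * (m00 * m22 + m10 * m12 + m20 * m02) = 0 ->
  2 * m11 * m21 - 4 * (m10 * m22 + m20 * m12) = 0 ->
  m21 ^+ 2 - 4 * m20 * m22 = 0 ->
  m10 ^+ 2 - 4 * m00 * m20 = 0 ->
  2 * m10 * m11 - 4 * (m00 * m21 + m01 * m20) = 0 ->
  2 * m11 * m12 - 4 * (m01 * m22 + m02 * m21) = 0 ->
  m12 ^+ 2 - 4 * m02 * m22 = 0 ->
  exists b00 b01 b10 b11 : F,
  [/\ m00 = b00 ^+ 2, m01 = 2 * b00 * b01 & m02 = b01 ^+ 2] /\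
  [/\ m10 = 2 * b00 * b10, m11 = 2 * (b00 * b11 + b01 * b10)
    & m12 = 2 * b01 * b11] /\
  [/\ m20 = b10 ^+ 2, m21 = 2 * b10 * b11 & m22 = b11 ^+ 2].
Proof.
move=> y0 y1 y2 y3 y4 x0 x1 x3 x4.
have [z00|n] := eqVneq m00 0; last exact: biquadratic_square_corner.
have [z02|n] := eqVneq m02 0; last first.
  have [|||||b00 [b01 [b10 [b11 [[e1 e2 e3] [[e4 e5 e6] [e7 e8 e9]]]]]]] :=
    @biquadratic_square_corner m02 m01 m00 m12 m11 m10 m22 m21 m20 n.
  - by rewrite -[RHS]y0; ring.
  - by rewrite -[RHS]y1; ring.
  - by rewrite -[RHS]y2; ring.
  - by rewrite -[RHS]x4; ring.
  - by rewrite -[RHS]x3; ring.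
  exists b01, b00, b11, b10.
  by rewrite e1 e2 e3 e4 e5 e6 e7 e8 e9; do !split; ring.
have [z20|n] := eqVneq m20 0; last first.
  have [|||||b00 [b01 [b10 [b11 [[e1 e2 e3] [[e4 e5 e6] [e7 e8 e9]]]]]]] :=
    @biquadratic_square_corner m20 m21 m22 m10 m11 m12 m00 m01 m02 n.
  - by rewrite -[RHS]y4; ring.
  - by rewrite -[RHS]y3; ring.
  - by rewrite -[RHS]y2; ring.
  - by rewrite -[RHS]x0; ring.
  - by rewrite -[RHS]x1; ring.
  exists b10, b11, b00, b01.
  by rewrite e1 e2 e3 e4 e5 e6 e7 e8 e9; do !split; ring.
have [z22|n] := eqVneq m22 0; last first.
  have [|||||b00 [b01 [b10 [b11 [[e1 e2 e3] [[e4 e5 e6] [e7 e8 e9]]]]]]] :=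
    @biquadratic_square_corner m22 m21 m20 m12 m11 m10 m02 m01 m00 n.
  - by rewrite -[RHS]y4; ring.
  - by rewrite -[RHS]y3; ring.
  - by rewrite -[RHS]y2; ring.
  - by rewrite -[RHS]x4; ring.
  - by rewrite -[RHS]x3; ring.
  exists b11, b10, b01, b00.
  by rewrite e1 e2 e3 e4 e5 e6 e7 e8 e9; do !split; ring.
have sqr0 (x : F) : x ^+ 2 = 0 -> x = 0 by move/eqP; rewrite sqrf_eq0 => /eqP.
subst m00 m02 m20 m22.
have z01 : m01 = 0 by apply: sqr0; rewrite -[RHS]y0; ring.
have z10 : m10 = 0 by apply: sqr0; rewrite -[RHS]x0; ring.
have z21 : m21 = 0 by apply: sqr0; rewrite -[RHS]y4; ring.
have z12 : m12 = 0 by apply: sqr0; rewrite -[RHS]x4; ring.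
subst m01 m10 m21 m12.
have -> : m11 = 0 by apply: sqr0; rewrite -[RHS]y2; ring.
by exists 0, 0, 0, 0; do !split; ring.
Qed.

(** The five expressions are the coefficients in x of the discriminant of the slice along (1, x).
    Two nonroots give two independent slices. *)
Lemma rank_le_disc t :
  rank_le 4 t \/
  [/\ pol (t 0 0) (t 0 1) ^+ 2 - 4 * det2 (t 0 0) * det2 (t 0 1) = 0,
      2 * pol (t 0 0) (t 0 1) * (pol (t 0 0) (t 1 1) + pol (t 0 1) (t 1 0))
      - 4 * (det2 (t 0 0) * pol (t 0 1) (t 1 1)
             + pol (t 0 0) (t 1 0) * det2 (t 0 1)) = 0,
      (pol (t 0 0) (t 1 1) + pol (t 0 1) (t 1 0)) ^+ 2
      + 2 * pol (t 0 0) (t 0 1) * pol (t 1 0) (t 1 1)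
      - 4 * (det2 (t 0 0) * det2 (t 1 1)
             + pol (t 0 0) (t 1 0) * pol (t 0 1) (t 1 1)
             + det2 (t 1 0) * det2 (t 0 1)) = 0,
      2 * (pol (t 0 0) (t 1 1) + pol (t 0 1) (t 1 0)) * pol (t 1 0) (t 1 1)
      - 4 * (pol (t 0 0) (t 1 0) * det2 (t 1 1)
             + det2 (t 1 0) * pol (t 0 1) (t 1 1)) = 0 &
      pol (t 1 0) (t 1 1) ^+ 2 - 4 * det2 (t 1 0) * det2 (t 1 1) = 0].
Proof.
set c0 := (X in X = 0); set c1 := (X in _ \/ [/\ _, X = 0, _, _ & _]).
set c2 := (X in _ \/ [/\ _, _, X = 0, _ & _]).
set c3 := (X in _ \/ [/\ _, _, _, X = 0 & _]).
set c4 := (X in _ \/ [/\ _, _, _, _ & X = 0]).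
have [[x [y [xy qx qy]]]|] := quartic_nonroots c0 c1 c2 c3 c4; last by right.
left; apply: (@rank_le_slices t (vec2 1 x) (vec2 1 y)).
- by rewrite /vec2 /= mul1r mulr1 subr_eq0 eq_sym.
- apply: contra_neq qx => <-.
  by rewrite /c0 /c1 /c2 /c3 /c4 /vec2 /det2 /pol /=; ring.
- apply: contra_neq qy => <-.
  by rewrite /c0 /c1 /c2 /c3 /c4 /vec2 /det2 /pol /=; ring.
Qed.

Lemma rank_le4 t : rank_le 4 t.
Proof.
have [//|[y0 y1 y2 y3 y4]] := rank_le_disc t.
have [/rank_le_swap//|[x0 x1 _ x3 x4]] := rank_le_disc (fun i j => t j i).
have polC m n : pol m n = pol n m by rewrite /pol; ring.
have [|||||||||b00 [b01 [b10 [b11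
  [[e00 e01 e02] [[e10 e11 e12] [e20 e21 e22]]]]]]]
  := @biquadratic_square (det2 (t 0 0)) (pol (t 0 0) (t 0 1)) (det2 (t 0 1))
  (pol (t 0 0) (t 1 0)) (pol (t 0 0) (t 1 1) + pol (t 0 1) (t 1 0))
  (pol (t 0 1) (t 1 1)) (det2 (t 1 0)) (pol (t 1 0) (t 1 1)) (det2 (t 1 1))
  => //.
- by rewrite (polC (t 0 1)) -[RHS]x1; ring.
- by rewrite (polC (t 0 1) (t 1 0)) -[RHS]x3; ring.
(* F determines det t(z) up to a multiple of det z, which vanishes at every x (x) y; comparing
   coefficients of z00 z11 fixes that multiple. *)
apply: (@rank_le_form (pol (t 0 0) (t 1 1) - 2 * b00 * b11)
  (fun i j => vec2 (vec2 b00 b01 j) (vec2 b10 b11 j) i)).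
move=> z00 z01 z10 z11.
have -> : det2 (comb t z00 z01 z10 z11) =
  z00 ^+ 2 * det2 (t 0 0) + z01 ^+ 2 * det2 (t 0 1) + z10 ^+ 2 * det2 (t 1 0)
  + z11 ^+ 2 * det2 (t 1 1) + z00 * z01 * pol (t 0 0) (t 0 1)
  + z00 * z10 * pol (t 0 0) (t 1 0) + z01 * z11 * pol (t 0 1) (t 1 1)
  + z10 * z11 * pol (t 1 0) (t 1 1)
  + z01 * z10 * (pol (t 0 0) (t 1 1) + pol (t 0 1) (t 1 0))
  + (z00 * z11 - z01 * z10) * pol (t 0 0) (t 1 1).
  by rewrite /det2 /pol /comb; ring.
by rewrite e00 e01 e02 e10 e11 e12 e20 e21 e22 /vec2 /=; ring.
Qed.

End Order4.

(** * Arbitrary order and existence of the maximal rank *)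

Section Tensors.
Variable F : numClosedFieldType.

(** Unlike in [rank_one], the vectors may be zero, so the number of terms can be fixed in
    advance. *)
Definition outer_sum n (t : tensor2 F n) d :=
  exists v : 'I_d -> 'I_n -> 'rV[F]_2, t = \sum_(e < d) outer_product (v e).

Lemma outer_sum4 (t : tensor2 F 4) : outer_sum t 4.
Proof.
pose idx (i j k l : 'I_2) : {ffun 'I_4 -> 'I_2} :=
  [ffun a : 'I_4 => nth 0 [:: i; j; k; l] a].
have [u [v [w [x tE]]]] := rank_le4 (fun i j k l => t (idx i j k l)).
exists (fun e a => \row_c nth (u e) [:: u e; v e; w e; x e] a c).
apply/ffunP => f; rewrite sum_ffunE.
have -> : t f = t (idx (f ord0) (f (lift ord0 ord0))
    (f (lift ord0 (lift ord0 ord0)))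
    (f (lift ord0 (lift ord0 (lift ord0 ord0))))).
  congr (t _); apply/ffunP => -[[|[|[|[|//]]]] ha]; rewrite ffunE /=;
    congr (f _); exact: val_inj.
rewrite tE; apply: eq_bigr => e _.
by rewrite ffunE !big_ord_recl big_ord0 !mxE /= mulr1 !mulrA.
Qed.

(** Slicing along the first index gives t = e0 (x) t_0 + e1 (x) t_1, with [d] terms for each
    slice. *)
Lemma outer_sumS n (t : tensor2 F n.+1) d :
  (forall t' : tensor2 F n, outer_sum t' d) -> outer_sum t (d + d).
Proof.
move=> IH.
pose ext c (f : {ffun 'I_n -> 'I_2}) : {ffun 'I_n.+1 -> 'I_2} :=
  [ffun a => oapp f c (unlift ord0 a)].
have slice c := IH [ffun f => t (ext c f)].
have [v0 t0] := slice 0; have [v1 t1] := slice 1.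
pose cons c (v : 'I_n -> 'rV[F]_2) a : 'rV[F]_2 :=
  oapp v (delta_mx 0 c) (unlift ord0 a).
exists (fun e => match split e with
  inl e => cons 0 (v0 e) | inr e => cons 1 (v1 e) end).
have consE c v f : outer_product (cons c v) f
    = (f ord0 == c)%:R * outer_product v [ffun a => f (lift ord0 a)].
  rewrite !ffunE big_ord_recl /cons unlift_none /= mxE eqxx /=; congr (_ * _).
  by apply: eq_bigr => a _; rewrite liftK /= ffunE.
apply/ffunP => f; rewrite sum_ffunE big_split_ord /=.
pose f' : {ffun 'I_n -> 'I_2} := [ffun a => f (lift ord0 a)].
have -> : t f = [ffun h => t (ext (f ord0) h)] f'.
  rewrite ffunE; congr (t _); apply/ffunP => a; rewrite ffunE.
  by case: unliftP => [b ->|->] /=; rewrite ?ffunE.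
under eq_bigr => e _ do rewrite (unsplitK (inl e : 'I_d + 'I_d)) consE.
under [X in _ + X]eq_bigr => e _ do
  rewrite (unsplitK (inr e : 'I_d + 'I_d)) consE.
rewrite -!mulr_sumr -!sum_ffunE -t0 -t1.
by case: (ord2P (f ord0)) => ->; rewrite /= ?mul1r ?mul0r ?addr0 ?add0r.
Qed.

Lemma outer_sum_exp n (t : tensor2 F n.+4) : outer_sum t (2 ^ n.+2).
Proof.
elim: n t => [|n IH] t; first exact: outer_sum4.
by rewrite expnS mul2n -addnn; apply: outer_sumS.
Qed.

Lemma outer_product_eq0 n (v : 'I_n -> 'rV[F]_2) k :
  v k = 0 -> outer_product v = 0.
Proof.
by move=> vk; apply/ffunP => f; rewrite !ffunE (bigD1 k) //= vk mxE mul0r.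
Qed.

(** Terms containing a zero vector vanish and are dropped; the remaining ones have rank one. *)
Lemma sum_of_rank_ones_outer_sum n (t : tensor2 F n) d :
  outer_sum t d -> exists2 s, sum_of_rank_ones t s & (s <= d)%N.
Proof.
case=> v ->; elim: d v => [|d IH] v.
  by exists 0%N => //; exists (fun=> 0); [case|rewrite !big_ord0].
have [s [u u1 uE] sd] := IH (fun e => v (lift ord0 e)).
have [v0|] := boolP [forall k, v ord0 k != 0]; last first.
  move=> /forallPn[k /negPn/eqP/outer_product_eq0 v0].
  by exists s; [exists u => //; rewrite big_ord_recl v0 add0r | exact: leqW].
exists s.+1 => //.
exists (fun e => oapp u (outer_product (v ord0)) (unlift ord0 e)).
  move=> e; case: unliftP => [e' _ /=|_ /=]; first exact: u1.
  by exists (v ord0) => //; apply/forallP.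
rewrite !big_ord_recl unlift_none /=; congr (_ + _).
by rewrite uE; apply: eq_bigr => e _; rewrite liftK.
Qed.

Lemma is_rank_exists n (t : tensor2 F n) d :
  sum_of_rank_ones t d -> exists2 s, is_rank t s & (s <= d)%N.
Proof.
move=> td; have ex : exists s, `[< sum_of_rank_ones t s >].
  by exists d; apply/asboolP.
case: (ex_minnP ex) => s /asboolP ts smin.
exists s; last by apply: smin; apply/asboolP.
by split=> // s' ts'; apply: smin; apply/asboolP.
Qed.

(** The attained ranks are bounded by [d] and include that of the zero tensor, so they have a
    maximum. *)
Lemma is_maximal_rank_exists n d :
  (forall t : tensor2 F n, exists2 s, sum_of_rank_ones t s & (s <= d)%N) ->
  exists2 r, is_maximal_rank F n r & (r <= d)%N.
Proof.
move=> bound.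
have rank (t : tensor2 F n) : exists2 s, is_rank t s & (s <= d)%N.
  have [s ts sd] := bound t; have [s' ts' s's] := is_rank_exists ts.
  by exists s' => //; apply: leq_trans sd.
pose attained s := `[< exists t : tensor2 F n, is_rank t s >].
have ex : exists s, attained s.
  by have [s0 t0 _] := rank 0; exists s0; apply/asboolP; exists 0.
have le s : attained s -> (s <= d)%N.
  move=> /asboolP[t [_ smin]]; have [s' ts' s'd] := bound t.
  exact: leq_trans (smin _ ts') s'd.
case: (ex_maxnP ex le) => r /[dup] /le rd /asboolP tr rmax.
exists r => //; split=> // t; have [s ts _] := rank t.
by exists s => //; apply: rmax; apply/asboolP; exists t.
Qed.

End Tensors.

Theorem corollary6p2 (R : realType) (n : nat) (hn : (4 <= n)%N) :
  exists2 r : nat, is_maximal_rank (complex R) n r & (r <= 2 ^ (n - 2))%N.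
Proof.
apply: is_maximal_rank_exists => t; apply: sum_of_rank_ones_outer_sum.
by case: n hn t => [|[|[|[|n]]]] // _ t; apply: (outer_sum_exp t).
Qed.
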